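(* Let $R\ge 1$. For all $m\ge\mathrm{poly}(d)$, with probability at least $1-\exp(-\Omega(m^{1/3}))$ over the random initialization $a^{(0)},W^{(0)},b^{(0)}$, the following holds simultaneously for all $W\in\mathbb{R}^{d\times m}$ with $\|W-W^{(0)}\|_{2,\infty}\le R/m^{2/3}$: $$\sup_{x\in\mathcal{X}}|f_W(x)-g_W(x)|\le O\Big(\frac{R^2}{m^{1/6}}\Big).$$
   Context: $\mathcal{X}:=\{x\in\mathbb{R}^d:\|x\|_2=1,\ x_d=1/2\}$. $\sigma(z)=\max\{z,0\}$. For $W\in\mathbb{R}^{d\times m}$ with columns $W_r$: $f_W(x)=\sum_{r=1}^m a_r^{(0)}\sigma(\langle W_r,x\rangle+b_r^{(0)})$ and the pseudo-network $g_W(x)=\sum_{r=1}^m a_r^{(0)}\langle W_r-W_r^{(0)},x\rangle\,\mathbf{1}\{\langle W_r^{(0)},x\rangle+b_r^{(0)}\ge0\}$. Initialization: entries of $W^{(0)}$ and $b^{(0)}$ i.i.d. $\mathcal{N}(0,1/m)$; entries of $a^{(0)}$ i.i.d. uniform on $\{-m^{-1/3},+m^{-1/3}\}$; all independent. $\|W\|_{2,\infty}=\max_r\|W_r\|_2$ (maximum column $\ell_2$ norm). *)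

(* Defs.v *)
From HB Require Import structures.
From mathcomp Require Import all_boot all_order all_algebra.
From mathcomp Require Import all_classical all_reals all_analysis.
Set Implicit Arguments. Unset Strict Implicit. Unset Printing Implicit Defensive.
Import Order.TTheory GRing.Theory Num.Theory.
Local Open Scope classical_set_scope.
Local Open Scope ring_scope.

(** Index set of the random initialization: entries W0_{j r} (j < d, r < m),
    biases b0_r, output weights a0_r. *)
Definition init_index (d m : nat) : finType :=
  (('I_d * 'I_m) + ('I_m + 'I_m))%type.

Section defs.
Variable R : realType.

Definition relu (z : R) : R := Num.max z 0.

Definition dotp (d : nat) (u x : 'I_d -> R) : R := \sum_(j < d) u j * x j.

Definition l2norm (d : nat) (x : 'I_d -> R) : R := Num.sqrt (\sum_(j < d) x j ^+ 2).

Definition col_of (d m : nat) (W : 'M[R]_(d, m)) (r : 'I_m) : 'I_d -> R :=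
  fun j => W j r.

Definition norm2inf (d m : nat) (W : 'M[R]_(d, m)) : R :=
  \big[Num.max/0]_(r < m) l2norm (col_of W r).

Definition Xset (d : nat) : set ('I_d -> R) :=
  [set x | l2norm x = 1 /\ forall i : 'I_d, val i = d.-1 -> x i = 2^-1].

Definition fnet (d m : nat) (a b : 'I_m -> R) (W : 'M[R]_(d, m)) (x : 'I_d -> R) : R :=
  \sum_(r < m) a r * relu (dotp (col_of W r) x + b r).

Definition gnet (d m : nat) (a b : 'I_m -> R) (W0 W : 'M[R]_(d, m)) (x : 'I_d -> R) : R :=
  \sum_(r < m) a r * dotp (col_of (W - W0) r) x *
               (if 0 <= dotp (col_of W0 r) x + b r then 1 else 0).

Definition sym_two_point (c : R) (B : set R) : \bar R :=
  ((2^-1)%:E * (\1_B c)%:E + (2^-1)%:E * (\1_B (- c))%:E)%E.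

(** Marginal law of each coordinate of the initialization:
    W0 and b0 entries ~ N(0, 1/m) (standard deviation sqrt(1/m)),
    a0 entries uniform on {-m^{-1/3}, +m^{-1/3}}. *)
Definition init_law (d m : nat) (i : init_index d m) : set R -> \bar R :=
  match i with
  | inl _ => normal_prob 0 (Num.sqrt (m%:R^-1))
  | inr (inl _) => normal_prob 0 (Num.sqrt (m%:R^-1))
  | inr (inr _) => sym_two_point ((m%:R : R) `^ (- (3^-1)))
  end.

Definition indep_with_laws {dT : measure_display} {T : measurableType dT}
    (P : probability T R) (I : finType) (X : I -> T -> R)
    (mu : I -> set R -> \bar R) : Prop :=
  (forall i, measurable_fun setT (X i)) /\
  forall B : I -> set R, (forall i, measurable (B i)) ->
    P (\bigcap_(i in [set: I]) (X i @^-1` B i)) = (\prod_(i : I) mu i (B i))%E.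

End defs.

(* Main.v *)
(* Write u_r = <W0_r, x> + b0_r and e_r = <W_r - W0_r, x>, so |e_r| <= R m^(-2/3).
   Then f_W(x) - g_W(x) is f_{W0}(x) plus the sum over r of
   a_r (relu(u_r + e_r) - relu(u_r) - e_r 1{u_r >= 0}), and the r-th term of this sum
   vanishes unless |u_r| <= |e_r|.
   For fixed x, the symmetry of the signs a_r makes f_{W0}(x) sub-Gaussian with variance
   proxy of order m^(-2/3), so |f_{W0}(x)| = O(m^(-1/6)) outside an event of probability
   exp(-K m^(1/3)).  Since b0_r has density at most m^(1/2), each u_r falls in the window
   |u_r| <= 2 R m^(-2/3) with probability O(R m^(-1/6)), and a Chernoff bound makes the
   number of such r at most O(R m^(5/6)); the sum is then O(R^2 m^(-1/6)).
   Both estimates pass to all x through a grid of mesh m^(-2)/12: it has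
   exp(O(d log m)) = exp(O(m^(1/3))) points, and the bound |W0_jr| <= 12 makes rounding
   harmless. *)

Require Import Defs.
From HB Require Import structures.
From mathcomp Require Import all_boot all_order all_algebra.
From mathcomp Require Import all_classical all_reals all_analysis.
From mathcomp Require Import measurable_realfun ring lra.
Import Order.TTheory GRing.Theory Num.Theory.
Local Open Scope classical_set_scope.
Local Open Scope ring_scope.

(** * Independence of disjoint groups of coordinates *)

Section independence.
Context {dT : measure_display} {T : measurableType dT} {R : realType}.
Variables (P : probability T R).
Local Open Scope ereal_scope.

Definition independent2 {d1 d2} {U : measurableType d1} {V : measurableType d2}
    (f : T -> U) (g : T -> V) := forall (A : set U) (B : set V),
  measurable A -> measurable B ->
  P (f @^-1` A `&` g @^-1` B) = P (f @^-1` A) * P (g @^-1` B).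

(** Independence on rectangles makes the law of [(f, g)] the product of the two marginal laws, by
    uniqueness of the product measure; Tonelli then applies. *)
Lemma independent2_fubini {d1 d2} {U : measurableType d1} {V : measurableType d2}
    (f : T -> U) (g : T -> V) (F : U * V -> \bar R) :
  measurable_fun setT f -> measurable_fun setT g -> independent2 f g ->
  measurable_fun setT F -> (forall z, 0 <= F z) ->
  \int[P]_t F (f t, g t) = \int[P]_s \int[P]_t F (f s, g t).
Proof.
move=> mf mg fg mF F0.
have mfg : measurable_fun setT (fun t => (f t, g t)).
  by apply/measurable_fun_pairP; split.
pose f' : {mfun T >-> U} := HB.pack f (isMeasurableFun.Build _ _ _ _ f mf).
pose g' : {mfun T >-> V} := HB.pack g (isMeasurableFun.Build _ _ _ _ g mg).
pose fg' : {mfun T >-> (U * V)%type} :=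
  HB.pack (fun t => (f t, g t)) (isMeasurableFun.Build _ _ _ _ _ mfg).
rewrite -[LHS]/(\int[P]_t (F \o fg') t) -ge0_integral_distribution//.
rewrite (@eq_measure_integral _ _ _ setT
  (distribution P f' \x distribution P g')%E); last first.
  move=> A mA _; apply/esym/product_measure_unique => //.
rewrite fubini_tonelli1//=.
rewrite ge0_integral_distribution//=.
- apply: eq_integral => s _ /=; rewrite /fubini_F.
  by rewrite ge0_integral_distribution//; exact: measurableT_comp.
- exact: measurable_fun_fubini_tonelli_F.
- by move=> x; exact: integral_ge0.
Qed.

(** The partial integral is the Tonelli section of [F] against the law of [g], composed with [f].
    This measurability is what lets the iterated integrals below be compared pointwise in the outer
    variable. *)
Lemma measurable_integral_section {d1 d2} {U : measurableType d1}
    {V : measurableType d2} (f : T -> U) (g : T -> V) (F : U * V -> \bar R) :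
  measurable_fun setT f -> measurable_fun setT g ->
  measurable_fun setT F -> (forall z, 0 <= F z) ->
  measurable_fun setT (fun s => \int[P]_t F (f s, g t)).
Proof.
move=> mf mg mF F0.
pose g' : {mfun T >-> V} := HB.pack g (isMeasurableFun.Build _ _ _ _ g mg).
have mG : measurable_fun setT (fubini_F (distribution P g') F).
  exact: measurable_fun_fubini_tonelli_F.
apply: eq_measurable_fun (measurableT_comp mG mf) => s _ /=; rewrite /fubini_F.
by rewrite ge0_integral_distribution//; exact: measurableT_comp.
Qed.

Lemma independent2_integralM (f g : T -> R) :
  measurable_fun setT f -> measurable_fun setT g -> independent2 f g ->
  (forall t, 0 <= f t)%R -> (forall t, 0 <= g t)%R ->
  \int[P]_t (f t * g t)%:E = (\int[P]_t (f t)%:E) * (\int[P]_t (g t)%:E).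
Proof.
move=> mf mg fg f0 g0.
(* The absolute values make the integrand nonnegative on the whole plane, as Tonelli requires, and
   not only at the values taken by [f] and [g]. *)
transitivity (\int[P]_t (`|f t| * `|g t|)%:E).
  by apply: eq_integral => t _; rewrite !ger0_norm.
rewrite (independent2_fubini f g (fun z => (`|z.1| * `|z.2|)%:E))//; last first.
  by apply/measurable_EFinP/measurable_funM; exact: measurableT_comp.
rewrite -ge0_integralZr//; last 3 first.
- by apply/measurable_EFinP.
- by move=> t _; rewrite lee_fin.
- by apply: integral_ge0 => t _; rewrite lee_fin.
apply: eq_integral => s _ /=.
rewrite -ge0_integralZl//; last 3 first.
- by apply/measurable_EFinP.
- by move=> t _; rewrite lee_fin.
- by rewrite lee_fin.
by apply: eq_integral => t _; rewrite !ger0_norm.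
Qed.

Context {I : finType} {X : I -> T -> R} {mu : I -> set R -> \bar R}.
Hypothesis XP : indep_with_laws P X mu.
Hypothesis mu1 : forall i, mu i setT = 1.

(** A pi-system: events that constrain only coordinates in [J]. It generates the sigma-algebra of
    these coordinates. *)
Definition cylinders (J : {pred I}) : set (set T) :=
  [set A | exists B : I -> set R, [/\ forall i, measurable (B i),
     forall i, i \notin J -> B i = setT &
     A = \bigcap_(i in [set: I]) X i @^-1` B i]].

(** A copy of [T] carrying the smaller sigma-algebra, so that dependence on the coordinates in [J]
    alone becomes ordinary measurability. *)
Definition sigma_of (J : {pred I}) := g_sigma_algebraType (cylinders J).

Lemma cylinders_setI J : setI_closed (cylinders J).
Proof.
move=> _ _ [B [mB BT ->]] [C [mC CT ->]].
exists (fun i => B i `&` C i); split.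
- by move=> i; exact: measurableI.
- by move=> i iJ; rewrite BT// CT// setIT.
- rewrite -bigcapI; apply: eq_bigcapr => i _.
  by rewrite preimage_setI.
Qed.

Lemma cylindersT J : cylinders J setT.
Proof.
exists (fun=> setT); split=> //.
by apply/esym; rewrite -subTset => t _ i _.
Qed.

Lemma cylinders_measurable J : cylinders J `<=` measurable.
Proof.
move=> _ [B [mB BT ->]]; apply: fin_bigcap_measurable => // i _.
by rewrite -[X in measurable X]setTI; apply: XP.1.
Qed.

Lemma sigma_of_measurable J (A : set T) :
  (cylinders J).-sigma.-measurable A -> measurable A.
Proof.
by apply: smallest_sub; [exact: sigma_algebra_measurable|exact: cylinders_measurable].
Qed.

Lemma measurable_sigma_of J {d'} {U : measurableType d'} (f : T -> U) :
  measurable_fun (setT : set (sigma_of J)) f -> measurable_fun setT f.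
Proof.
move=> mf _ Y mY; rewrite setTI; apply: (@sigma_of_measurable J).
by rewrite -[X in measurable X]setTI; apply: mf.
Qed.

Lemma measurable_coord J i : i \in J ->
  measurable_fun (setT : set (sigma_of J)) (X i).
Proof.
move=> iJ _ Y mY; rewrite setTI; apply: sub_sigma_algebra.
exists (fun j => if j == i then Y else setT); split.
- by move=> j; case: ifP.
- by move=> j; case: ifPn => // /eqP ->; rewrite iJ.
- apply/seteqP; split => t /=.
    by move=> Yt j _ /=; case: ifPn => // /eqP ->.
  by move=> /(_ i Logic.I) /=; rewrite eqxx.
Qed.

(** At each coordinate one of the two constraints is [setT], of mass 1, so the product formula
    splits factor by factor. *)
Lemma cylinders_indep J K A B : (forall i, i \in J -> i \notin K) ->
  cylinders J A -> cylinders K B -> P (A `&` B) = P A * P B.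
Proof.
move=> JK [C [mC CT ->]] [D [mD DT ->]].
rewrite -bigcapI.
under eq_bigcapr do rewrite -preimage_setI.
rewrite !XP.2//; last by move=> i; exact: measurableI.
rewrite -big_split; apply: eq_bigr => i _ /=.
case: (boolP (i \in J)) => [/JK/DT ->|/CT ->]; rewrite mu1.
  by rewrite setIT mule1.
by rewrite setTI mul1e.
Qed.

Lemma law_coord i B : measurable B -> P (X i @^-1` B) = mu i B.
Proof.
move=> mB.
rewrite (_ : _ @^-1` _ = \bigcap_(j in [set: I])
   X j @^-1` (if j == i then B else setT)); last first.
  apply/seteqP; split => t /=.
    by move=> Yt j _ /=; case: ifPn => // /eqP ->.
  by move=> /(_ i Logic.I) /=; rewrite eqxx.
rewrite XP.2 => [|j]; last by case: ifP.
rewrite (bigD1 i)//= eqxx big1 ?mule1// => j /negbTE ->.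
exact: mu1.
Qed.

(** Independence extends from the pi-systems to the sigma-algebras one argument at a time, by
    uniqueness of measures. *)
Lemma sigma_of_indep J K A B : (forall i, i \in J -> i \notin K) ->
  (cylinders J).-sigma.-measurable A -> (cylinders K).-sigma.-measurable B ->
  P (A `&` B) = P A * P B.
Proof.
move=> JK mA mB.
(* With [B'] fixed, the measures sending [C] to [P (C & B')] (intersection) and to [P C * P B']
   agree on the cylinders, hence on the sigma-algebra they generate. *)
have step J' A' B' : cylinders J' `<=` measurable -> measurable B' ->
    (forall C, cylinders J' C -> P (C `&` B') = P C * P B') ->
    (cylinders J').-sigma.-measurable A' -> P (A' `&` B') = P A' * P B'.
  move=> cJ mB' H mA'.
  have PB : P B' \is a fin_num by exact: fin_num_measure.
  have PB0 : (0 <= fine (P B'))%R by exact: fine_ge0.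
  have := @g_sigma_algebra_measure_unique _ _ _ (cylinders J') cJ (fun=> setT)
    (fun=> cylindersT J') _ (mrestr P mB') (mscale (NngNum PB0) P)
    (@cylinders_setI J') _ _ A' mA'.
  have mE C : mscale (NngNum PB0) P C = P C * P B'.
    by rewrite /mscale/= fineK// muleC.
  rewrite -(mE A'); apply.
  - by apply: bigcup_const; exists 0%N.
  - by move=> C /H HC; apply: etrans HC _; rewrite -mE.
  - by move=> _; rewrite ltey_eq; apply/orP; left; exact: fin_num_measure.
apply: (step J) => //; first exact: cylinders_measurable.
  exact: sigma_of_measurable mB.
move=> C cC; rewrite setIC muleC; apply: (step K) => //.
- exact: cylinders_measurable.
- exact: cylinders_measurable cC.
by move=> D cD; rewrite setIC muleC; exact: (cylinders_indep J K).
Qed.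

Lemma sigma_of_independent2 J K {d1 d2} {U : measurableType d1}
    {V : measurableType d2} (f : T -> U) (g : T -> V) :
  (forall i, i \in J -> i \notin K) ->
  measurable_fun (setT : set (sigma_of J)) f ->
  measurable_fun (setT : set (sigma_of K)) g -> independent2 f g.
Proof.
move=> JK mf mg A B mA mB; apply: (@sigma_of_indep J K) => //.
  by rewrite -[X in measurable X]setTI; apply: mf.
by rewrite -[X in measurable X]setTI; apply: mg.
Qed.

Lemma sigma_of_sub J K {d'} {U : measurableType d'} (f : T -> U) :
  {subset J <= K} ->
  measurable_fun (setT : set (sigma_of J)) f ->
  measurable_fun (setT : set (sigma_of K)) f.
Proof.
move=> JK mf _ Y mY; rewrite setTI.
have : (cylinders J).-sigma.-measurable (f @^-1` Y).
  by rewrite -[X in measurable X]setTI; apply: mf.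
apply: sub_sigma_algebra2 => A [B [mB BT ->]]; exists B; split=> // i iK.
by apply: BT; apply: contra iK; exact: JK.
Qed.

(** Induction on [s]: the product of the remaining factors depends only on the union [L] of their
    blocks, which is disjoint from [J k]. *)
Lemma integral_prod_blocks (K : eqType) (s : seq K) (J : K -> {pred I})
    (f : K -> T -> R) :
  uniq s -> (forall k l i, k != l -> i \in J k -> i \notin J l) ->
  (forall k, measurable_fun (setT : set (sigma_of (J k))) (f k)) ->
  (forall k t, 0 <= f k t)%R ->
  \int[P]_t (\prod_(k <- s) f k t)%:E = \prod_(k <- s) \int[P]_t (f k t)%:E.
Proof.
move=> us JJ mf f0.
elim: s us => [_|k s IH /= /andP[ks us]].
  under eq_integral do rewrite big_nil.
  by rewrite big_nil integral_cst// mul1e; exact: probability_setT.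
rewrite big_cons -IH//.
pose L : {pred I} := [pred i | has (fun l => i \in J l) s].
have mL : measurable_fun (setT : set (sigma_of L)) (fun t => \prod_(l <- s) f l t)%R.
  apply: measurable_prod => l ls; apply: sigma_of_sub (mf l) => i iJ.
  by apply/hasP; exists l.
under eq_integral do rewrite big_cons.
apply: independent2_integralM => //.
- exact: measurable_sigma_of (mf k).
- exact: measurable_sigma_of mL.
- apply: (@sigma_of_independent2 (J k) L) => // i iJ.
  apply/hasPn => l ls; apply: JJ iJ.
  by apply: contraNneq ks => ->.
- by move=> t; exact: prodr_ge0.
Qed.

End independence.

(** * Gaussian and two-point laws *)

Section gaussian.
Context {R : realType}.
Local Open Scope ereal_scope.

Lemma ge0_integral_normal_prob (m s : R) (f : R -> \bar R) :
  measurable_fun setT f -> (forall x, 0 <= f x) ->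
  \int[normal_prob m s]_x f x =
  \int[lebesgue_measure]_x (f x * (normal_pdf m s x)%:E).
Proof.
move=> mf f0.
have dom := normal_prob_dominates m s.
have mpdf : measurable_fun setT (EFin \o normal_pdf m s).
  by apply/measurable_EFinP; exact: measurable_normal_pdf.
rewrite -(Radon_Nikodym_SigmaFinite.change_of_variables dom)//.
have mRN : measurable_fun setT
    (Radon_Nikodym_SigmaFinite.f (normal_prob m s) lebesgue_measure).
  exact: measurable_int (Radon_Nikodym_SigmaFinite.f_integrable dom).
(* The abstract Radon-Nikodym derivative and [normal_pdf] have the same integral over every
   measurable set, so they agree almost everywhere. *)
apply: ae_eq_integral => //; [exact: emeasurable_funM..|].
apply: ae_eqe_mul2l; apply: integral_ae_eq => //.
  exact: Radon_Nikodym_SigmaFinite.f_integrable.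
by move=> E _ mE; rewrite -Radon_Nikodym_SigmaFinite.f_integral.
Qed.

(** Completing the square: the exponential tilt turns the centred density into the density centred
    at [t * s ^+ 2], up to the constant on the right. *)
Lemma normal_prob_mgf (s t : R) : s != 0%R ->
  \int[normal_prob 0 s]_x (expR (t * x))%:E = (expR (t ^+ 2 * s ^+ 2 / 2))%:E.
Proof.
move=> s0.
rewrite ge0_integral_normal_prob//; last first.
  apply/measurable_EFinP/measurableT_comp => //; exact: mulrl_measurable.
have mpdf m : measurable_fun setT (EFin \o normal_pdf m s).
  by apply/measurable_EFinP; exact: measurable_normal_pdf.
transitivity (\int[lebesgue_measure]_x ((expR (t ^+ 2 * s ^+ 2 / 2))%:E *
    (normal_pdf (t * s ^+ 2) s x)%:E)); last first.
  rewrite ge0_integralZl//; last 2 first.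
  - exact: mpdf.
  - by move=> x _; rewrite lee_fin normal_pdf_ge0.
  by rewrite integral_normal_pdf mule1.
apply: eq_integral => x _; rewrite -!EFinM !normal_pdfE//; congr EFin.
rewrite /= mulrCA [RHS]mulrCA; congr (_ * _)%R.
rewrite /normal_fun -!expRD; congr expR.
by field.
Qed.

(** The density never exceeds its peak, which is at most [s^-1], and the interval has length
    [2 * r]. *)
Lemma normal_prob_ball_le (s a r : R) : (0 < s)%R -> (0 <= r)%R ->
  normal_prob 0 s `[(a - r)%R, (a + r)%R] <= (2 * r / s)%:E.
Proof.
move=> s0 r0.
rewrite /normal_prob.
apply: (@le_trans _ _ (\int[lebesgue_measure]_(x in `[(a - r)%R, (a + r)%R]) (s^-1)%:E)).
  apply: ge0_le_integral => //.
  - by move=> x _; rewrite lee_fin normal_pdf_ge0.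
  - apply/measurable_EFinP/measurable_funTS; exact: measurable_normal_pdf.
  - move=> x _; rewrite lee_fin (le_trans (normal_pdf_ub _ _ _))// ?gt_eqF//.
    rewrite /normal_peak lef_pV2 ?posrE//; last first.
      by rewrite sqrtr_gt0 mulrn_wgt0// mulr_gt0 ?pi_gt0// exprn_gt0.
    rewrite -[leLHS]ger0_norm ?(ltW s0)// -sqrtr_sqr ler_wsqrtr//.
    rewrite -mulrnAr ler_peMr ?sqr_ge0//.
    have := pi_ge2 R; lra.
rewrite integral_cst//.
have lm : lebesgue_measure ([set` `[(a - r)%R, (a + r)%R]] : set R) <= (2 * r)%:E.
  rewrite lebesgue_measure_itv/= lte_fin.
  by case: ifPn => _; rewrite -?EFinB lee_fin; lra.
apply: le_trans (lee_wpmul2l _ lm) _; first by rewrite lee_fin invr_ge0 ltW.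
by rewrite -EFinM lee_fin mulrC.
Qed.

Context {d : measure_display} {T : measurableType d} (P : probability T R).

Lemma normal_law_mgf (Y : T -> R) (s t : R) : measurable_fun setT Y ->
  (forall B, measurable B -> P (Y @^-1` B) = normal_prob 0 s B) -> s != 0%R ->
  \int[P]_w (expR (t * Y w))%:E = (expR (t ^+ 2 * s ^+ 2 / 2))%:E.
Proof.
move=> mY lawY s0; rewrite -normal_prob_mgf//.
have mY' : measurable_fun setT (Y : T -> measurableTypeR R) by exact: mY.
pose Y' : {mfun T >-> measurableTypeR R} :=
  HB.pack (Y : T -> measurableTypeR R)
    (isMeasurableFun.Build _ _ T (measurableTypeR R) _ mY').
transitivity (\int[distribution P Y']_x (expR (t * x))%:E); last first.
  by apply: eq_measure_integral => A mA _; exact: lawY.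
rewrite ge0_integral_distribution//.
by apply/measurable_EFinP/measurableT_comp => //; exact: mulrl_measurable.
Qed.

End gaussian.

Lemma measurable_relu {R : realType} : measurable_fun setT (@relu R).
Proof. by apply: measurable_maxr => //; exact: measurable_cst. Qed.

Section laws.
Context {dT : measure_display} {T : measurableType dT} {R : realType}.
Variables (P : probability T R).
Local Open Scope ereal_scope.

(* Only the density of [b] is used, so no convolution of Gaussians is needed. *)
Lemma gaussian_small_ball (v b : T -> R) (s r : R) :
  measurable_fun setT v -> measurable_fun setT b -> independent2 P v b ->
  (forall B, measurable B -> P (b @^-1` B) = normal_prob 0 s B) ->
  (0 < s)%R -> (0 <= r)%R ->
  P [set t | `|v t + b t| <= r]%R <= (2 * r / s)%:E.
Proof.
move=> mv mb ivb lawb s0 r0.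
pose A : set (R * R) := [set z | `|z.1 + z.2| <= r]%R.
have mA : measurable A.
  rewrite /A -[X in measurable X]setTI.
  apply: measurable_fun_ler => //; apply: measurableT_comp => //.
  exact: measurable_funD.
have mvb : measurable_fun setT (fun t => (v t, b t)).
  by apply/measurable_fun_pairP; split.
have mI : measurable [set t | `|v t + b t| <= r]%R.
  rewrite -[X in measurable X]setTI.
  by apply: (mvb _ A).
have m1A : measurable_fun setT (fun z : R * R => (\1_A z : R)%:E).
  exact/measurable_EFinP/measurable_indic.
rewrite -[X in P X]setIT -integral_indic//.
rewrite -[leLHS]/(\int[P]_t (fun z : R * R => (\1_A z : R)%:E) (v t, b t)).
rewrite independent2_fubini//.
apply: (@le_trans _ _ (\int[P]_w (2 * r / s)%:E)); last first.
  rewrite integral_cst// [X in _ * X](_ : _ = 1) ?mule1//.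
  exact: probability_setT.
apply: ge0_le_integral => //.
- by move=> w _; apply: integral_ge0.
- exact: measurable_integral_section m1A _.
move=> w _ /=.
rewrite -[leLHS]/(\int[P]_t (\1_[set t | A (v w, b t)] t : R)%:E).
(* Once [v] is frozen at the value [v w], the event says that [b] lies within [r] of [- v w]. *)
pose B : set R := `[(- v w - r)%R, (- v w + r)%R]%classic.
have -> : [set t | A (v w, b t)] = b @^-1` B.
  apply/seteqP; split => t; rewrite /A /B /= in_itv/= ler_norml => /andP[? ?].
    by apply/andP; split; lra.
  by apply/andP; split; lra.
rewrite integral_indic//; last first.
  by rewrite -[X in measurable X]setTI; apply: mb => //; exact: measurable_itv.
rewrite setIT; apply: le_trans (normal_prob_ball_le s (- v w)%R r s0 r0).
have mB : measurable B by exact: measurable_itv.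
rewrite le_eqVlt; apply/orP; left; apply/eqP; exact: (lawb B mB).
Qed.

(** The law of [a] is half the sum of two Dirac masses, so the integral is the mean of the two
    values. *)
Lemma two_point_integral (a : T -> R) (c : R) (f : R -> \bar R) :
  measurable_fun setT a ->
  (forall B, measurable B -> P (a @^-1` B) = sym_two_point c B) ->
  measurable_fun setT f -> (forall x, 0 <= f x) ->
  \int[P]_t f (a t) = (2^-1)%:E * (f c + f (- c)%R).
Proof.
move=> ma lawa mf f0.
pose a' : {mfun T >-> R} := HB.pack a (isMeasurableFun.Build _ _ _ _ a ma).
have h0 : (0 <= 2^-1 :> R)%R by [].
pose nu := measure_add (mscale (NngNum h0) (dirac c))
  (mscale (NngNum h0) (dirac (- c)%R)).
transitivity (\int[distribution P a']_x f x).
  by rewrite ge0_integral_distribution.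
transitivity (\int[nu]_x f x); last first.
  rewrite ge0_integral_measure_add// !ge0_integral_mscale//.
  by rewrite !integral_dirac// !diracT !mul1e ge0_muleDr.
apply: eq_measure_integral => A mA _.
apply: etrans (lawa A mA) _; apply/esym.
exact: measure_addE.
Qed.

(* Averaging over the sign [a] leaves cosh (l c relu u), and cosh is even and
   nondecreasing in the absolute value, so relu u may be replaced by u. *)
Lemma sign_relu_mgf (u a : T -> R) (c l : R) :
  measurable_fun setT u -> measurable_fun setT a -> independent2 P u a ->
  (forall B, measurable B -> P (a @^-1` B) = sym_two_point c B) ->
  \int[P]_t (expR (l * (a t * relu (u t))))%:E <=
  (2^-1)%:E * (\int[P]_t (expR (l * c * u t))%:E
               + \int[P]_t (expR (- (l * c) * u t))%:E).
Proof.
move=> mu ma iua lawa.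
have mrelu := @measurable_relu R.
have mF : measurable_fun setT
    (fun z : R * R => (expR (l * (z.2 * relu z.1)))%:E).
  apply/measurable_EFinP/measurableT_comp => //.
  apply: measurable_funM => //; apply: measurable_funM => //.
  exact: measurableT_comp.
have me k : measurable_fun setT (fun t => (expR (k * u t))%:E).
  apply/measurable_EFinP/measurableT_comp => //.
  exact: measurable_funM.
rewrite -[leLHS]/(\int[P]_t
  (fun z : R * R => (expR (l * (z.2 * relu z.1)))%:E) (u t, a t)).
rewrite independent2_fubini// -ge0_integralD//.
rewrite -ge0_integralZl//; last 2 first.
- exact: emeasurable_funD.
- by move=> t _; rewrite adde_ge0// lee_fin expR_ge0.
apply: ge0_le_integral => //.
- by move=> t _; apply: integral_ge0.
- exact: measurable_integral_section mF _.
- apply: emeasurable_funM => //; exact: emeasurable_funD.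
move=> t _ /=.
rewrite (two_point_integral a c (fun y => (expR (l * (y * relu (u t))))%:E))//;
  last first.
  apply/measurable_EFinP/measurableT_comp => //.
  by apply: measurable_funM => //; apply: measurable_funM => //.
rewrite -!EFinD -!EFinM lee_fin ler_pM2l//.
rewrite /relu; set y := (l * c)%R.
rewrite mulNr mulNr mulrN !mulrA -/y.
(* For negative [u t] the claim is [2 <= e + e^-1], that is [(e - 1) ^+ 2 >= 0]; otherwise both
   sides coincide. *)
have [u0|u0] := ltP (u t) 0%R.
  rewrite mulr0 oppr0 expR0.
  have := expR_gt0 (y * u t); set e := expR _ => e0.
  rewrite expRN -/e.
  have ei : (e * e^-1 = 1)%R by rewrite divff// gt_eqF.
  have i0 : (0 < e^-1)%R by rewrite invr_gt0.
  have := sqr_ge0 (e - 1)%R; nra.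
by rewrite lexx.
Qed.

End laws.

(** * Moment generating functions at initialization *)

Section gaussian_combination.
Context {dT : measure_display} {T : measurableType dT} {R : realType}.
Context (P : probability T R) {I : finType} {X : I -> T -> R}.
Context {mu : I -> set R -> \bar R}.
Hypothesis XP : indep_with_laws P X mu.
Hypothesis mu1 : forall i, mu i setT = 1%E.

Lemma gaussian_combination_mgf (s : seq I) (w : I -> R) (sg : R) :
  uniq s -> sg != 0 -> (forall i, i \in s -> mu i = normal_prob 0 sg) ->
  (\int[P]_t (expR (\sum_(i <- s) w i * X i t))%:E =
   (expR (sg ^+ 2 / 2 * \sum_(i <- s) w i ^+ 2))%:E)%E.
Proof.
move=> us sg0 mus.
under eq_integral do rewrite expR_sum.
have mX i : measurable_fun setT (X i) := XP.1 i.
rewrite (integral_prod_blocks P XP mu1 _ s (fun i => pred1 i)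
  (fun i t => expR (w i * X i t)))//; last 2 first.
- by move=> i j k ij /eqP ->; rewrite inE.
- move=> i; apply: measurableT_comp => //; apply: measurable_funM => //.
  by apply: measurable_coord; rewrite inE.
rewrite mulr_sumr expR_sum -prodEFin [LHS]big_seq [RHS]big_seq.
apply: eq_bigr => i iS.
rewrite (normal_law_mgf P (X i) sg)//; last first.
  by move=> B mB; rewrite (law_coord P XP mu1)// mus.
by congr (expR _)%:E; lra.
Qed.

End gaussian_combination.

Lemma lee_prodEFin {R : realType} (K : Type) (s : seq K) (F : K -> \bar R)
    (G : K -> R) :
  (forall k, 0 <= F k)%E -> (forall k, F k <= (G k)%:E)%E ->
  (\prod_(k <- s) F k <= (\prod_(k <- s) G k)%:E)%E.
Proof.
move=> F0 FG; elim: s => [|k s IH]; first by rewrite !big_nil.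
rewrite !big_cons EFinM; apply: lee_pmul => //.
by apply: prode_ge0.
Qed.

Section initialization.
Context {dT : measure_display} {T : measurableType dT} {R : realType}.
Context (P : probability T R) {d m : nat} {X : init_index d m -> T -> R}.
Hypothesis m0 : (0 < m)%N.
Hypothesis XP : indep_with_laws P X (@init_law R d m).

Let sg : R := Num.sqrt (m%:R^-1).
Let c : R := (m%:R : R) `^ (- (3^-1)).

Let sg0 : 0 < sg.
Proof. by rewrite sqrtr_gt0 invr_gt0 ltr0n. Qed.

Lemma sym_two_point_setT (z : R) : sym_two_point z setT = 1%E.
Proof.
rewrite /sym_two_point indicT/= -!EFinM -EFinD.
by congr EFin; lra.
Qed.

Lemma init_law_setT i : @init_law R d m i setT = 1%E.
Proof.
case: i => [?|[?|?]] /=; [exact: probability_setT..|exact: sym_two_point_setT].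
Qed.

Let mX i : measurable_fun setT (X i) := XP.1 i.

Definition preact (x : 'I_d -> R) (r : 'I_m) (t : T) : R :=
  dotp (fun j => X (inl (j, r)) t) x + X (inr (inl r)) t.

Lemma measurable_preact_sigma_of (J : {pred (init_index d m)}) x r :
  (forall j, inl (j, r) \in J) -> inr (inl r) \in J ->
  measurable_fun (setT : set (sigma_of (X := X) J)) (preact x r).
Proof.
move=> wJ bJ; apply: measurable_funD; last exact: measurable_coord.
apply: measurable_sum => j; apply: measurable_funM => //.
exact: measurable_coord.
Qed.

Lemma measurable_preact x r : measurable_fun setT (preact x r).
Proof.
apply: (measurable_sigma_of P XP predT).
exact: measurable_preact_sigma_of.
Qed.

(** A preactivation combines independent Gaussians with coefficients [x j] for the weights and 1 for
    the bias; the latter gives the [+ 1]. *)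
Lemma preact_mgf x r k :
  (\int[P]_t (expR (k * preact x r t))%:E =
   (expR (k ^+ 2 * sg ^+ 2 / 2 * (\sum_j x j ^+ 2 + 1)))%:E)%E.
Proof.
pose s : seq (init_index d m) :=
  inr (inl r) :: [seq inl (j, r) | j <- enum 'I_d].
pose w (i : init_index d m) := if i is inl (j, _) then k * x j else k.
have us : uniq s.
  rewrite /= map_inj_uniq ?enum_uniq ?andbT; last by move=> ? ? [].
  by apply/mapP => -[].
have sumE (F : init_index d m -> R) :
    \sum_(i <- s) F i = F (inr (inl r)) + \sum_j F (inl (j, r)).
  by rewrite /s big_cons big_map big_enum.
transitivity (\int[P]_t (expR (\sum_(i <- s) w i * X i t))%:E)%E.
  apply: eq_integral => t _; rewrite sumE /preact /dotp mulrDr addrC mulr_sumr.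
  congr (expR (_ + _))%:E.
  by apply: eq_bigr => j _; rewrite /w; ring.
rewrite (gaussian_combination_mgf P XP init_law_setT s w sg) //; last 2 first.
- exact: lt0r_neq0.
- by move=> i; rewrite inE => /orP[/eqP ->//|/mapP[j _ ->]].
congr (expR _)%:E; rewrite sumE /w.
under eq_bigr do rewrite exprMn.
by rewrite -mulr_sumr; ring.
Qed.

(** The fibres of this map are the disjoint blocks of coordinates over which the moment generating
    functions factor. *)
Definition neuron (i : init_index d m) : 'I_m :=
  match i with inl (_, r) => r | inr (inl r) => r | inr (inr r) => r end.

Definition is_weight (i : init_index d m) := if i is inl _ then true else false.
Definition is_sign (i : init_index d m) := if i is inr (inr _) then true else false.

Lemma neuron_disjoint (r r' : 'I_m) i : r != r' ->
  i \in [pred i | neuron i == r] -> i \notin [pred i | neuron i == r'].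
Proof. by move=> rr; rewrite !inE => /eqP ->. Qed.

(** Neurons are independent, and [sign_relu_mgf] reduces each factor to [preact_mgf] at [l * c] and
    [- (l * c)], which give the same value. The norm of [x] is left free because the bound is
    applied at grid points off the sphere. *)
Lemma net_mgf x l :
  (\int[P]_t (expR (l * \sum_r X (inr (inr r)) t * relu (preact x r t)))%:E <=
   (expR (m%:R * (l ^+ 2 * c ^+ 2 * sg ^+ 2 / 2 * (\sum_j x j ^+ 2 + 1))))%:E)%E.
Proof.
have mrelu := @measurable_relu R.
under eq_integral do rewrite mulr_sumr expR_sum.
rewrite (integral_prod_blocks P XP init_law_setT _ (index_enum 'I_m)
  (fun r => [pred i | neuron i == r])
  (fun r t => expR (l * (X (inr (inr r)) t * relu (preact x r t)))))//; last 3 first.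
- exact: index_enum_uniq.
- by move=> r r' i; exact: neuron_disjoint.
- move=> r; apply: measurableT_comp => //; apply: measurable_funM => //.
  apply: measurable_funM; first by apply: measurable_coord; rewrite inE/=.
  apply: measurableT_comp => //.
  by apply: measurable_preact_sigma_of => [j|]; rewrite inE /=.
set v := l ^+ 2 * c ^+ 2 * sg ^+ 2 / 2 * _.
apply: le_trans (lee_prodEFin _ _ _ (fun=> expR v) _ _) _.
- by move=> r; apply: integral_ge0.
- move=> r; apply: le_trans (sign_relu_mgf P (preact x r) _ c l _ _ _ _) _ => //.
  + exact: measurable_preact.
  + apply: (sigma_of_independent2 P XP init_law_setT
      [pred i | ~~ is_sign i] [pred i | is_sign i]).
    * by move=> i; rewrite !inE.
    * by apply: measurable_preact_sigma_of => [j|]; rewrite inE.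
    * by apply: measurable_coord; rewrite inE.
  + by move=> B mB; rewrite (law_coord P XP init_law_setT).
  rewrite !preact_mgf -EFinD -EFinM lee_fin sqrrN.
  rewrite (_ : (l * c) ^+ 2 * _ / 2 * _ = v); last by rewrite /v exprMn; ring.
  lra.
- by rewrite big_const_ord iter_mulr_1 -expRM_natl.
Qed.

Lemma small_preact_le x r (b : R) : 0 <= b ->
  (P [set t | (`|preact x r t| <= b)%R] <= (2 * b / sg)%:E)%E.
Proof.
move=> b0; apply: (gaussian_small_ball P
  (fun t => dotp (fun j => X (inl (j, r)) t) x) (X (inr (inl r)))) => //.
- by apply: measurable_sum => j; apply: measurable_funM => //; exact: mX.
- apply: (sigma_of_independent2 P XP init_law_setT
    [pred i | is_weight i] [pred i | ~~ is_weight i]).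
  + by move=> i; rewrite !inE negbK.
  + apply: measurable_sum => j; apply: measurable_funM => //.
    by apply: measurable_coord; rewrite inE.
  + by apply: measurable_coord; rewrite inE.
- by move=> B mB; rewrite (law_coord P XP init_law_setT).
Qed.

(** A real-valued indicator, so that its sum over [r] counts neurons and can be exponentiated. *)
Definition near_kink (x : 'I_d -> R) (b : R) (r : 'I_m) (t : T) : R :=
  (`|preact x r t| <= b)%R%:R.

Lemma measurable_near_kink (J : {pred init_index d m}) x b r :
  (forall j, inl (j, r) \in J) -> inr (inl r) \in J ->
  measurable_fun (setT : set (sigma_of (X := X) J)) (near_kink x b r).
Proof.
move=> wJ bJ.
rewrite (_ : near_kink x b r = \1_[set t | `|preact x r t| <= b]); last first.
  apply/funext => t; rewrite indicE; congr (_%:R).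
  by congr nat_of_bool; apply/idP/idP; rewrite inE.
apply: measurable_indic; rewrite -[X in measurable X]setTI.
apply: measurable_fun_ler => //; apply: measurableT_comp => //.
exact: measurable_preact_sigma_of.
Qed.

(** Chernoff: since [expR 2^-1 <= 2], each factor is at most one plus the probability of the window,
    hence at most the exponential of the bound on that probability. *)
Lemma count_mgf x b : 0 <= b ->
  (\int[P]_t (expR (2^-1 * \sum_r near_kink x b r t))%:E <=
   (expR (m%:R * (2 * b / sg)))%:E)%E.
Proof.
move=> b0.
under eq_integral do rewrite mulr_sumr expR_sum.
rewrite (integral_prod_blocks P XP init_law_setT _ (index_enum 'I_m)
  (fun r => [pred i | neuron i == r])
  (fun r t => expR (2^-1 * near_kink x b r t)))//; last 3 first.
- exact: index_enum_uniq.
- by move=> r r' i; exact: neuron_disjoint.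
- move=> r; apply: measurableT_comp => //; apply: measurable_funM => //.
  by apply: measurable_near_kink => [j|]; rewrite inE /=.
apply: le_trans (lee_prodEFin _ _ _ (fun=> expR (2 * b / sg)) _ _) _.
- by move=> r; apply: integral_ge0.
- move=> r.
  have mb : measurable [set t | `|preact x r t| <= b].
    rewrite -[X in measurable X]setTI.
    apply: measurable_fun_ler => //; apply: measurableT_comp => //.
    exact: measurable_preact.
  have m1 : measurable_fun setT (fun t => (\1_[set t | `|preact x r t| <= b] t : R)%:E).
    exact/measurable_EFinP/measurable_indic.
  apply: (@le_trans _ _ (\int[P]_t (1 + (\1_[set t | `|preact x r t| <= b] t : R)%:E))%E).
    apply: ge0_le_integral => //.
    + apply/measurable_EFinP/measurableT_comp => //; apply: measurable_funM => //.
      by apply: (measurable_sigma_of P XP predT); exact: measurable_near_kink.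
    + exact: emeasurable_funD.
    + move=> t _; rewrite lee_fin indicE /near_kink.
      have -> : (t \in [set t | `|preact x r t| <= b]) = (`|preact x r t| <= b).
        by apply/idP/idP; rewrite inE.
      case: (_ <= b) => /=; last by rewrite mulr0 expR0 addr0.
      (* The bound [expR 2^-1 <= 2] comes from [expR (- 2^-1) >= 1 - 2^-1] by inversion. *)
      have := expR_ge1Dx (- 2^-1 : R); rewrite mulr1 expRN.
      have := expR_gt0 (2^-1 : R); set e := expR _ => e0 h.
      have h2 : 2^-1 <= e^-1 by lra.
      by rewrite -[leLHS]invrK -[leRHS]invrK lef_pV2 ?posrE ?invr_gt0//; lra.
  rewrite ge0_integralD// integral_cst// integral_indic// setIT mul1e.
  apply: (@le_trans _ _ (1 + (2 * b / sg)%:E)%E).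
    by apply: leeD; [rewrite [leLHS]probability_setT|exact: small_preact_le].
  by rewrite -EFinD lee_fin expR_ge1Dx.
- by rewrite big_const_ord iter_mulr_1 -expRM_natl.
Qed.

Lemma weight_mgf j r k :
  (\int[P]_t (expR (k * X (inl (j, r)) t))%:E =
   (expR (k ^+ 2 * sg ^+ 2 / 2))%:E)%E.
Proof.
apply: normal_law_mgf => //; last exact: lt0r_neq0.
by move=> B mB; rewrite (law_coord P XP init_law_setT).
Qed.

(** Almost sure equality is phrased as a vanishing integral, so that it enters the union bound as a
    term with bound 0. *)
Lemma sign_norm_ae r :
  (\int[P]_t ((`|X (inr (inr r)) t| != c)%:R)%:E = 0)%E.
Proof.
have c0 : 0 <= c by exact: powR_ge0.
pose B : set R := ~` [set c; - c].
have mB : measurable B by apply: measurableC; apply: measurableU.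
transitivity (\int[P]_t (\1_(X (inr (inr r)) @^-1` B) t : R)%:E)%E.
  apply: eq_integral => t _; rewrite indicE; congr (_%:R)%:E; congr nat_of_bool.
  rewrite eqr_norml c0 andbT; apply/idP/idP; rewrite inE.
    by move=> h /= [] e; move: h; rewrite e eqxx ?orbT.
  by move=> h; apply/negP => /orP[]/eqP e; apply: h; [left|right].
rewrite integral_indic//; last by rewrite -[X in measurable X]setTI; apply: mX.
rewrite setIT; apply: etrans (law_coord P XP init_law_setT _ _ mB) _.
rewrite /= /sym_two_point !indicE !memNset ?mule0 ?adde0//.
  by move=> /(_ (or_intror erefl)).
by move=> /(_ (or_introl erefl)).
Qed.

End initialization.

(** * Deterministic estimates and failure probability *)

Section union_bound.
Context {dT : measure_display} {T : measurableType dT} {R : realType}.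
Context (P : probability T R).

(* Markov's inequality for the sum of all [F k] replaces a union bound over the
   events [1 <= F k]. *)
Lemma markov_union (K : finType) (F : K -> T -> R) (B : K -> R) (e : R) :
  (forall k, measurable_fun setT (F k)) -> (forall k t, 0 <= F k t) ->
  (forall k, (\int[P]_t (F k t)%:E <= (B k)%:E)%E) -> \sum_k B k <= e ->
  exists E : set T, [/\ measurable E, ((1 - e)%:E <= P E)%E &
    forall t, E t -> forall k, F k t < 1].
Proof.
move=> mF F0 FB Be.
pose Z t := \sum_k F k t.
have mZ : measurable_fun setT Z by apply: measurable_sum.
have Z0 t : 0 <= Z t by apply: sumr_ge0.
have ZE : (\int[P]_t (Z t)%:E <= e%:E)%E.
  under eq_integral do rewrite /Z -sumEFin.
  rewrite ge0_integral_sum//; last 2 first.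
  - by move=> k; apply/measurable_EFinP.
  - by move=> k t _; rewrite lee_fin.
  apply: (@le_trans _ _ (\sum_k (B k)%:E)%E); first exact: lee_sum.
  by rewrite sumEFin lee_fin.
have mE : measurable [set t | 1 <= Z t].
  rewrite -[X in measurable X]setTI.
  by apply: measurable_fun_ler => //; exact: measurable_cst.
have PE : (P [set t | (1 <= Z t)%R] <= e%:E)%E.
  apply: le_trans ZE; rewrite -[X in P X]setIT -integral_indic//.
  apply: ge0_le_integral => //.
  - exact/measurable_EFinP/measurable_indic.
  - by apply/measurable_EFinP.
  move=> t _; rewrite lee_fin indicE.
  case: (boolP (_ \in _)) => //=; by rewrite inE.
exists (~` [set t | 1 <= Z t]); split; first exact: measurableC.
  rewrite (probability_setC P mE) EFinB.
  exact: leeB.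
move=> t /= /negP; rewrite -ltNge => Zt k; apply: le_lt_trans Zt.
by rewrite /Z (bigD1 k)//= lerDl sumr_ge0.
Qed.

End union_bound.

Section deterministic.
Context {R : realType}.

(** [relu] is linear on each side of 0, so the left side vanishes unless adding [e] moves [u] across
    0, which forces [|u| <= |e|]. *)
Lemma relu_linearization (u e : R) :
  `|relu (u + e) - relu u - e * (if 0 <= u then 1 else 0)|
  <= `|e| * (`|u| <= `|e|)%R%:R.
Proof.
rewrite /relu ler_norml.
have e1 := ler_norm e; have e2 := ler_norm (- e); rewrite normrN in e2.
have e3 := normr_ge0 e.
case: (leP 0 u) => u0; case: (leP 0 (u + e)) => ue;
  rewrite ?mulr1 ?mulr0.
- rewrite [_ - _ - _](_ : _ = 0); last by ring.
  by rewrite oppr_le0 !mulr_ge0.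
- rewrite (ger0_norm u0).
  have -> : u <= `|e| by lra.
  by rewrite mulr1; apply/andP; split; lra.
- rewrite (ltr0_norm u0).
  have -> : - u <= `|e| by lra.
  by rewrite mulr1; apply/andP; split; lra.
- by rewrite !subr0 oppr_le0 !mulr_ge0.
Qed.

Lemma relu_lipschitz (u v : R) : `|relu u - relu v| <= `|u - v|.
Proof.
rewrite /relu ler_norml.
have e1 := ler_norm (u - v); have e2 := ler_norm (- (u - v)); rewrite normrN in e2.
by case: (leP u 0) => u0; case: (leP v 0) => v0; apply/andP; split; lra.
Qed.

(** Cauchy-Schwarz against a unit vector: the residual of [u] after projection on [x] has
    nonnegative squared norm. *)
Lemma dotp_le_l2norm (d : nat) (u x : 'I_d -> R) :
  \sum_j x j ^+ 2 = 1 -> `|dotp u x| <= l2norm u.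
Proof.
move=> x1; rewrite /l2norm -sqrtr_sqr ler_wsqrtr//.
have : 0 <= \sum_j (u j - dotp u x * x j) ^+ 2 by apply: sumr_ge0 => j _; exact: sqr_ge0.
under eq_bigr do rewrite sqrrB exprMn mulrCA -mulrnAr.
rewrite big_split sumrB -!mulr_sumr sumrMnl /= x1 -/(dotp u x); lra.
Qed.

Lemma dotp_close (d : nat) (u x y : 'I_d -> R) (K e : R) :
  (forall j, `|u j| <= K) -> (forall j, `|x j - y j| <= e) ->
  `|dotp u x - dotp u y| <= d%:R * (K * e).
Proof.
move=> uK xe; rewrite /dotp -sumrB.
apply: le_trans (ler_norm_sum _ _ _) _.
rewrite mulr_natl -[X in _ *+ X]card_ord -sumr_const; apply: ler_sum => j _.
by rewrite -mulrBr normrM ler_pM.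
Qed.

Lemma norm2inf_ge (d m : nat) (W : 'M[R]_(d, m)) r :
  l2norm (col_of W r) <= norm2inf W.
Proof. exact: le_bigmax. Qed.

(* The window [2 * v] absorbs both the perturbation [W - W0] and the passage from [x]
   to the grid point [x'], each of which moves a preactivation by at most [v]. *)
Lemma linearization_error (d m : nat) (a b : 'I_m -> R) (W0 W : 'M[R]_(d, m))
    (x x' : 'I_d -> R) (al K e v w N : R) :
  0 <= al -> 0 <= v -> (forall r, `|a r| = al) -> (forall j r, `|W0 j r| <= K) ->
  (forall j, `|x j - x' j| <= e) -> \sum_j x j ^+ 2 = 1 ->
  norm2inf (W - W0) <= v -> d%:R * (K * e) <= v ->
  `|fnet a b W0 x'| <= w ->
  \sum_r (`|dotp (col_of W0 r) x' + b r| <= 2 * v)%R%:R <= N ->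
  `|fnet a b W x - gnet a b W0 W x| <=
    w + m%:R * (al * (d%:R * (K * e))) + al * (v * N).
Proof.
move=> al0 v0 aal WK xe x1 Wv Kev fw nN.
pose u r := dotp (col_of W0 r) x + b r.
pose u' r := dotp (col_of W0 r) x' + b r.
pose dl r := dotp (col_of (W - W0) r) x.
have uu' r : `|u r - u' r| <= d%:R * (K * e).
  rewrite /u /u' [_ - _](_ : _ = dotp (col_of W0 r) x - dotp (col_of W0 r) x').
    by apply: dotp_close => // j; exact: WK.
  by ring.
have dlv r : `|dl r| <= v.
  apply: le_trans (dotp_le_l2norm _ _ _ x1) _.
  exact: le_trans (norm2inf_ge _ _ _ r) Wv.
(* Three sources of error: the initial network at the grid point, the rounding of [x] to [x'], and
   the linearization of each neuron. *)
have fnetE : fnet a b W x - gnet a b W0 W x =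
    fnet a b W0 x' + \sum_r a r * (relu (u r) - relu (u' r))
    + \sum_r a r * (relu (u r + dl r) - relu (u r)
                    - dl r * (if 0 <= u r then 1 else 0)).
  rewrite /fnet /gnet -sumrB -!big_split /=; apply: eq_bigr => r _.
  have -> : dotp (col_of W r) x + b r = u r + dl r.
    rewrite /u /dl addrAC; congr (_ + _); rewrite /dotp -big_split/=.
    by apply: eq_bigr => j _; rewrite /col_of !mxE; ring.
  by rewrite -/(u r) -/(u' r) -/(dl r); ring.
rewrite fnetE; apply: le_trans (ler_normD _ _) _; apply: lerD.
  apply: le_trans (ler_normD _ _) _; apply: lerD => //.
  apply: le_trans (ler_norm_sum _ _ _) _.
  rewrite mulr_natl -[X in _ *+ X]card_ord -sumr_const; apply: ler_sum => r _.
  rewrite normrM aal ler_wpM2l//.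
  exact: le_trans (relu_lipschitz _ _) (uu' r).
apply: le_trans (ler_norm_sum _ _ _) _.
apply: (@le_trans _ _ (\sum_r al * (v * (`|u' r| <= 2 * v)%R%:R))).
  apply: ler_sum => r _.
  rewrite normrM aal ler_wpM2l//.
  apply: le_trans (relu_linearization _ _) _.
  apply: ler_pM => //.
  (* The window around [u r] is exchanged for the one around [u' r]:
     [|u' r| <= |u' r - u r| + |u r| <= 2 * v]. *)
  rewrite ler_nat; case: (boolP (`|u r| <= `|dl r|)) => //= h.
  have -> // : `|u' r| <= 2 * v.
  have := uu' r; have := dlv r; have := ler_distD (u r) (u' r) 0.
  rewrite !subr0 (distrC (u' r)); lra.
by rewrite -!mulr_sumr; do 2 rewrite ler_wpM2l//.
Qed.

End deterministic.

(** * Grid approximation and the total failure probability *)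

Section grid.
Context {R : realType}.

Definition grid {d : nat} (M : nat) (k : {ffun 'I_d -> 'I_(2 * M).+1}) :
  'I_d -> R := fun j => (k j)%:R / M%:R - 1.

Lemma grid_approx (d M : nat) (x : 'I_d -> R) : (0 < M)%N ->
  (forall j, `|x j| <= 1) ->
  exists k, forall j, `|x j - grid M k j| <= M%:R^-1.
Proof.
move=> M0 x1; have M0' : 0 < M%:R :> R by rewrite ltr0n.
pose y j := (x j + 1) * M%:R.
exists [ffun j => inord (Num.truncn (y j))] => j.
have /andP[xl xu] : -1 <= x j <= 1 by rewrite -ler_norml.
have y0 : 0 <= y j by apply: mulr_ge0; [lra|exact: ltW].
have /andP[tl tu] := truncn_itv y0.
(* The index [2 * M] is reached at [x j = 1], hence [2 * M + 1] values per coordinate; the bound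
   makes [inord] return the truncation itself. *)
have ty : (Num.truncn (y j) < (2 * M).+1)%N.
  rewrite ltnS -(ler_nat R); apply: le_trans tl _.
  by rewrite natrM /y ler_wpM2r//; lra.
rewrite /grid ffunE inordK//.
have -> : x j - ((Num.truncn (y j))%:R / M%:R - 1)
    = (y j - (Num.truncn (y j))%:R) / M%:R.
  by rewrite /y; field; rewrite gt_eqF.
rewrite normrM [`|M%:R^-1|]gtr0_norm ?invr_gt0// ler_piMl ?invr_ge0 ?(ltW M0')//.
rewrite ger0_norm ?subr_ge0//.
by move: tu; rewrite -natr1; lra.
Qed.

(** Termwise, [y ^+ 2 <= 2 * x ^+ 2 + 2 * (x - y) ^+ 2], because the difference is
    [(2 * x - y) ^+ 2]. *)
Lemma sum_sqr_perturb (d : nat) (x y : 'I_d -> R) (e : R) :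
  \sum_j x j ^+ 2 = 1 -> (forall j, `|x j - y j| <= e) -> d%:R * e ^+ 2 <= 1 ->
  \sum_j y j ^+ 2 <= 4.
Proof.
move=> x1 xy de.
apply: (@le_trans _ _ (\sum_j (2 * x j ^+ 2 + 2 * e ^+ 2))).
  apply: ler_sum => j _.
  have : (x j - y j) ^+ 2 <= e ^+ 2.
    by rewrite -real_normK ?num_real// lerXn2r ?nnegrE// (le_trans _ (xy j)).
  have := sqr_ge0 (2 * x j - y j); rewrite !expr2; nra.
rewrite big_split/= -mulr_sumr x1 sumr_const card_ord -mulr_natl; lra.
Qed.

Lemma exprn_le_expR (q : R) n : 1 <= q -> q ^+ n <= expR (n%:R * (q - 1)).
Proof.
move=> q1; rewrite expRM_natl lerXn2r ?nnegrE ?expR_ge0//; first lra.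
have := expR_ge1Dx (q - 1); lra.
Qed.

(** The terms stand for large weights, large network values and crowded windows. Each is brought
    below [E], with total multiplicity 5, and [5 <= 8 <= expR (3 * q ^+ 2)] absorbs that factor. *)
Lemma failure_sum_le (q r : R) (d m : nat) :
  1 <= q -> 1 <= r -> m%:R = q ^+ 6 -> d%:R <= q ->
  (d * m)%:R * (2 * expR (- (23 / 2 * q ^+ 6))) +
  ((2 * (12 * m ^ 2)).+1 ^ d)%:R *
    (2 * expR (- (45 / 2 * q ^+ 2)) + expR (- (26 * (r * q ^+ 5)))) <=
  expR (- q ^+ 2).
Proof.
move=> q1 r1 mq dq.
have q0 : 0 <= q by lra.
have e8 : 8 <= expR (3 * q ^+ 2).
  have h : 2 ^+ 3 <= expR (3%:R * (2 - 1)) :> R by apply: exprn_le_expR; lra.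
  apply: (@le_trans _ _ (2 ^+ 3)); first by rewrite !exprS expr0; lra.
  apply: (le_trans h).
  by rewrite ler_expR; nra.
have q26 : q ^+ 2 <= q ^+ 6 by apply: ler_weXn2l.
have q25 : q ^+ 2 <= q ^+ 5 by apply: ler_weXn2l.
have qq2 : q <= q ^+ 2 by rewrite -[leLHS]expr1; apply: ler_weXn2l.
pose E := expR (- (9 / 2 * q ^+ 2)) : R.
have E0 : 0 < E by exact: expR_gt0.
have t1 : (d * m)%:R * expR (- (23 / 2 * q ^+ 6)) <= E.
  apply: (@le_trans _ _ (expR (7%:R * (q - 1)) * expR (- (23 / 2 * q ^+ 6)))).
    apply: ler_wpM2r; first exact: expR_ge0.
    apply: le_trans (exprn_le_expR _ _ q1).
    by rewrite natrM mq [q ^+ 7]exprS ler_wpM2r ?exprn_ge0.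
  by rewrite -expRD ler_expR; lra.
(* Each coordinate has [24 * q ^+ 12 + 1] values, at most [32 * q ^+ 12 <= expR (12 * q)]; the power
   [d <= q] gives [expR (12 * q ^+ 2)]. *)
have tG : ((2 * (12 * m ^ 2)).+1 ^ d)%:R <= expR (12 * q ^+ 2) :> R.
  rewrite natrX.
  have b1 : (2 * (12 * m ^ 2)).+1%:R <= expR (12 * q) :> R.
    rewrite -natr1 !natrM mq -exprD.
    have h := exprn_le_expR q 12 q1.
    have h2 : 1 <= q ^+ 12 by rewrite exprn_ege1.
    have h5 : 32 <= expR 5 :> R.
      have h' : 2 ^+ 5 <= expR (5%:R * (2 - 1)) :> R by apply: exprn_le_expR; lra.
      apply: (@le_trans _ _ (2 ^+ 5)); first by rewrite !exprS expr0; lra.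
      by apply: (le_trans h'); rewrite ler_expR; lra.
    apply: (@le_trans _ _ (expR 5 * expR (12%:R * (q - 1)))).
      apply: (@le_trans _ _ (32 * q ^+ 12)).
        by rewrite (_ : (6 + 6)%N = 12%N)//; lra.
      by apply: ler_pM; rewrite ?exprn_ge0.
    by rewrite -expRD ler_expR; lra.
  apply: (@le_trans _ _ (expR (12 * q) ^+ d)).
    by apply: lerXn2r; rewrite ?nnegrE ?expR_ge0.
  by rewrite -expRM_natl ler_expR; nra.
have t2 : ((2 * (12 * m ^ 2)).+1 ^ d)%:R * expR (- (45 / 2 * q ^+ 2)) <= E.
  apply: (@le_trans _ _ (expR (12 * q ^+ 2) * expR (- (45 / 2 * q ^+ 2)))).
    by apply: ler_wpM2r => //; exact: expR_ge0.
  by rewrite -expRD ler_expR; lra.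
have t3 : ((2 * (12 * m ^ 2)).+1 ^ d)%:R * expR (- (26 * (r * q ^+ 5))) <= E.
  apply: (@le_trans _ _ (expR (12 * q ^+ 2) * expR (- (26 * (r * q ^+ 5))))).
    by apply: ler_wpM2r => //; exact: expR_ge0.
  have h5 : q ^+ 5 <= r * q ^+ 5 by rewrite ler_peMl// exprn_ge0.
  by rewrite -expRD ler_expR; lra.
apply: (@le_trans _ _ (5 * E)); first lra.
apply: (@le_trans _ _ (expR (3 * q ^+ 2) * E)).
  by apply: ler_wpM2r; [exact: ltW|lra].
by rewrite -expRD ler_expR; lra.
Qed.

End grid.

(** * Simultaneous bounds at initialization on one good event *)

Lemma integral_expR_shift_le {dT : measure_display} {T : measurableType dT}
    {R : realType} (P : probability T R) (Y : T -> R) (v z : R) :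
  measurable_fun setT Y ->
  (\int[P]_t (expR (Y t))%:E <= (expR v)%:E)%E ->
  (\int[P]_t (expR (Y t - z))%:E <= (expR (v - z))%:E)%E.
Proof.
move=> mY Yv.
under eq_integral do rewrite expRD mulrC EFinM.
rewrite ge0_integralZl//; last first.
  by apply/measurable_EFinP/measurableT_comp.
by rewrite [v - z]addrC expRD EFinM lee_pmul2l// ?lte_fin ?expR_gt0.
Qed.

Section good_event.
Context {dT : measure_display} {T : measurableType dT} {R : realType}.
Context (P : probability T R) {d m : nat} {X : init_index d m -> T -> R}.
Hypothesis m0 : (0 < m)%N.
Hypothesis XP : indep_with_laws P X (@init_law R d m).
(* [q] stands for m^(1/6). *)
Context {q r : R}.
Hypotheses (q1 : 1 <= q) (r1 : 1 <= r) (mq : m%:R = q ^+ 6) (dq : d%:R <= q).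
Hypothesis sgE : Num.sqrt (m%:R^-1) = (q ^+ 3)^-1.
Hypothesis cE : (m%:R : R) `^ (- (3^-1)) = (q ^+ 2)^-1.

Let M := (12 * m ^ 2)%N.
Let G := {ffun 'I_d -> 'I_(2 * M).+1}.
Let g (k : G) : 'I_d -> R := grid M k.

Let net (x : 'I_d -> R) t := \sum_s X (inr (inr s)) t * relu (preact (X := X) x s t).
Let count (x : 'I_d -> R) t := \sum_s near_kink (X := X) x (2 * (r / q ^+ 4)) s t.

Let q0 : 0 < q. Proof. by rewrite (lt_le_trans _ q1). Qed.

Let mX i : measurable_fun setT (X i) := XP.1 i.

Let mnet x : measurable_fun setT (net x).
Proof.
apply: measurable_sum => s; apply: measurable_funM => //.
exact: measurableT_comp measurable_relu (measurable_preact P XP x s).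
Qed.

Let mcount x : measurable_fun setT (count x).
Proof.
apply: measurable_sum => s; apply: (measurable_sigma_of P XP predT).
exact: measurable_near_kink.
Qed.

(** The exponent is at most [q ^+ 2 / 2 * 5 - 25 * q ^+ 2]. Fixing only [l ^+ 2] covers both tails,
    [l = q ^+ 3] and [l = - q ^+ 3]. *)
Let net_tail (x : 'I_d -> R) (l : R) : \sum_j x j ^+ 2 <= 4 -> l ^+ 2 = q ^+ 6 ->
  (\int[P]_t (expR (l * net x t - 25 * q ^+ 2))%:E <=
   (expR (- (45 / 2 * q ^+ 2)))%:E)%E.
Proof.
move=> x4 lq.
apply: le_trans (integral_expR_shift_le P (fun t => l * net x t) _ _ _
  (net_mgf P m0 XP x l)) _.
  by apply: measurable_funM.
rewrite lee_fin ler_expR sgE cE mq lq.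
rewrite (_ : q ^+ 6 * _ = q ^+ 2 / 2 * (\sum_j x j ^+ 2 + 1)); last first.
  by field; rewrite gt_eqF.
have := sqr_ge0 q; nra.
Qed.

Lemma good_event : exists E : set T, [/\ measurable E,
  ((1 - expR (- q ^+ 2))%:E <= P E)%E &
  forall t, E t -> [/\ forall j s, `|X (inl (j, s)) t| <= 12,
    forall s, `|X (inr (inr s)) t| = (q ^+ 2)^-1 &
    forall k : G, \sum_j g k j ^+ 2 <= 4 ->
      `|net (g k) t| <= 25 / q /\ count (g k) t <= 60 * (r * q ^+ 5)]].
Proof.
pose D : finType := ('I_d * 'I_m)%type.
(* Failure events: each weight from above and from below, each sign, and for each grid point the two
   tails of the network and the count. *)
pose K : finType := ((D + D) + ('I_m + (G + (G + G))))%type.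
pose ok (k : G) := \sum_j g k j ^+ 2 <= 4.
(* [F i t < 1] excludes one failure event, whose Chernoff bound is [B i]. *)
pose F (i : K) (t : T) : R := match i with
  | inl (inl js) => expR (m%:R * X (inl js) t - 12 * m%:R)
  | inl (inr js) => expR (- m%:R * X (inl js) t - 12 * m%:R)
  | inr (inl s) => (`|X (inr (inr s)) t| != (q ^+ 2)^-1)%R%:R
  (* Grid points of squared norm above 4 get the value 0 and so impose no condition on the
     network. *)
  | inr (inr (inl k)) =>
      if ok k then expR (q ^+ 3 * net (g k) t - 25 * q ^+ 2) else 0
  | inr (inr (inr (inl k))) =>
      if ok k then expR (- q ^+ 3 * net (g k) t - 25 * q ^+ 2) else 0
  | inr (inr (inr (inr k))) =>
      expR (2^-1 * count (g k) t - 30 * (r * q ^+ 5))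
  end.
pose B (i : K) : R := match i with
  | inl _ => expR (- (23 / 2 * q ^+ 6))
  | inr (inl s) => 0
  | inr (inr (inl k)) => expR (- (45 / 2 * q ^+ 2))
  | inr (inr (inr (inl k))) => expR (- (45 / 2 * q ^+ 2))
  | inr (inr (inr (inr k))) => expR (- (26 * (r * q ^+ 5)))
  end.
have mF i : measurable_fun setT (F i).
  have mexp (Y : T -> R) (a z : R) : measurable_fun setT Y ->
      measurable_fun setT (fun t => expR (a * Y t - z)).
    move=> mY; apply: measurableT_comp => //.
    by apply: measurable_funB => //; apply: measurable_funM.
  case: i => [[js|js]|[s|[k|[k|k]]]] /=; try exact: mexp.
  - rewrite (_ : F _ = \1_[set t | `|X (inr (inr s)) t| != (q ^+ 2)^-1]).
      apply: measurable_indic.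
      have -> : [set t | `|X (inr (inr s)) t| != (q ^+ 2)^-1] =
          (fun t => `|X (inr (inr s)) t|) @^-1` (~` [set (q ^+ 2)^-1]).
        by apply/seteqP; split => t /= /eqP.
      rewrite -[X in measurable X]setTI.
      by apply: (measurableT_comp _ (mX _)) => //; exact: measurableC.
    apply/funext => t; rewrite indicE /F; congr (_%:R); congr nat_of_bool.
    by apply/idP/idP; rewrite inE.
  - by rewrite /F; case: (ok k); [exact: mexp|exact: measurable_cst].
  - by rewrite /F; case: (ok k); [exact: mexp|exact: measurable_cst].
have F0 i t : 0 <= F i t.
  case: i => [[js|js]|[s|[k|[k|k]]]]; rewrite /F ?expR_ge0//.
    by case: ifP => _; rewrite ?expR_ge0.
  by case: ifP => _; rewrite ?expR_ge0.
have FB i : (\int[P]_t (F i t)%:E <= (B i)%:E)%E.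
  case: i => [[[j s]|[j s]]|[s|[k|[k|k]]]] /=.
  (* Chernoff with parameter [m] and variance [1 / m]: the exponent is [m / 2 - 12 * m]. *)
  - apply: le_trans (integral_expR_shift_le P (fun t => m%:R * X (inl (j, s)) t)
      (m%:R ^+ 2 * Num.sqrt (m%:R^-1) ^+ 2 / 2) _ _ _) _.
    + by apply: measurable_funM.
    + by rewrite (weight_mgf P m0 XP).
    rewrite lee_fin ler_expR sgE mq.
    rewrite (_ : (q ^+ 6) ^+ 2 * _ / 2 = q ^+ 6 / 2); last first.
      by field; rewrite gt_eqF.
    lra.
  - apply: le_trans (integral_expR_shift_le P (fun t => - m%:R * X (inl (j, s)) t)
      ((- m%:R) ^+ 2 * Num.sqrt (m%:R^-1) ^+ 2 / 2) _ _ _) _.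
    + by apply: measurable_funM.
    + by rewrite (weight_mgf P m0 XP).
    rewrite lee_fin ler_expR sgE mq sqrrN.
    rewrite (_ : (q ^+ 6) ^+ 2 * _ / 2 = q ^+ 6 / 2); last first.
      by field; rewrite gt_eqF.
    lra.
  - by rewrite -cE (sign_norm_ae P XP).
  - case: (boolP (ok k)) => kk.
      by apply: net_tail => //; rewrite -exprM.
    by rewrite integral0 lee_fin expR_ge0.
  - case: (boolP (ok k)) => kk.
      by apply: net_tail => //; rewrite sqrrN -exprM.
    by rewrite integral0 lee_fin expR_ge0.
  - have b0 : 0 <= 2 * (r / q ^+ 4).
      by rewrite mulr_ge0// divr_ge0 ?exprn_ge0 ?(ltW q0)// (le_trans _ r1).
    apply: le_trans (integral_expR_shift_le P (fun t => 2^-1 * count (g k) t)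
      _ _ _ (count_mgf P m0 XP (g k) _ b0)) _.
      by apply: measurable_funM.
    rewrite lee_fin ler_expR sgE mq.
    (* The mean count is at most [4 * (r * q ^+ 5)]; subtracting the threshold 30 leaves the 26 in
       [B]. *)
    rewrite (_ : q ^+ 6 * _ = 4 * (r * q ^+ 5)); last first.
      by field; rewrite gt_eqF.
    lra.
have Bsum : \sum_i B i <= expR (- q ^+ 2).
  have cD : #|D| = (d * m)%N by rewrite card_prod !card_ord.
  have sumD (z : R) : \sum_(i : D) z = (d * m)%:R * z.
    by rewrite sumr_const cD mulr_natl.
  pose N := ((2 * (12 * m ^ 2)).+1 ^ d)%N.
  have cG : #|G| = N by rewrite card_ffun !card_ord.
  have sumG (z : R) : \sum_(i : G) z = N%:R * z.
    by rewrite sumr_const cG mulr_natl.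
  have := failure_sum_le q r d m q1 r1 mq dq; rewrite -/N.
  move: N cG sumG => N _ sumG; apply: le_trans.
  rewrite big_sumType/= big_sumType/= big_sumType/= big_sumType/= big_sumType/=.
  rewrite !sumD !sumG big1//; lra.
have [E [mE PE EF]] := markov_union P K F B _ mF F0 FB Bsum.
exists E; split=> // t Et.
have expR_lt (y z : R) : expR (y - z) < 1 -> y < z.
  by rewrite expR_lt1; lra.
have m_gt0 : 0 < m%:R :> R by rewrite ltr0n.
split.
- move=> j s; rewrite ler_norml.
  have /expR_lt h1 := EF t Et (inl (inl (j, s))).
  have /expR_lt h2 := EF t Et (inl (inr (j, s))).
  by apply/andP; split; nra.
- move=> s; have := EF t Et (inr (inl s)) => /=.
  by case: eqP => //= _; rewrite ltxx.
- move=> k kk; split; last first.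
    by have /expR_lt := EF t Et (inr (inr (inr (inr k)))); lra.
  have := EF t Et (inr (inr (inl k))); have := EF t Et (inr (inr (inr (inl k)))).
  rewrite /= /ok kk => /expR_lt h1 /expR_lt h2.
  have q3 : q ^+ 3 = q ^+ 2 * q by rewrite -exprSr.
  have q2 : 0 < q ^+ 2 by rewrite exprn_gt0.
  rewrite ler_norml -mulNr ler_pdivrMr// ler_pdivlMr//.
  by apply/andP; split; rewrite -(ler_pM2l q2); nra.
Qed.

End good_event.

(** * The bound uniform in [W] and [x] *)

Theorem theorem2 (R : realType) :
  exists (p : nat) (C0 c C : R), 0 < c /\ 0 < C /\
  forall (d m : nat) (Rr : R), (0 < d)%N -> 1 <= Rr ->
  C0 * (d%:R ^+ p) <= m%:R ->
  forall (dT : measure_display) (T : measurableType dT) (P : probability T R)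
         (X : init_index d m -> T -> R),
  indep_with_laws P X (@init_law R d m) ->
  exists E : set T, measurable E /\
    (P E >= (1 - expR (- c * (m%:R `^ (3^-1))))%:E)%E /\
    forall t, E t ->
      let W0 : 'M[R]_(d, m) := \matrix_(j, r) X (inl (j, r)) t in
      let b0 : 'I_m -> R := fun r => X (inr (inl r)) t in
      let a0 : 'I_m -> R := fun r => X (inr (inr r)) t in
      forall W : 'M[R]_(d, m),
        norm2inf (W - W0) <= Rr / (m%:R `^ (2 / 3)) ->
        forall x, Xset x ->
          `| fnet a0 b0 W x - gnet a0 b0 W0 W x | <= C * (Rr ^+ 2 / (m%:R `^ (6^-1))).
Proof.
(* The exponent 6 makes [d <= m^(1/6)]. The error terms add up to [25 + 1 + 60 = 86] times
   [Rr ^+ 2 / q], which 100 covers. *)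
exists 6%N, 1, 1, 100; split=> //; split=> // d m Rr d0 Rr1.
rewrite mul1r => dm dT T P X XP.
have m0 : (0 < m)%N.
  rewrite -(ltr_nat R); apply: lt_le_trans dm.
  by rewrite exprn_gt0// ltr0n.
pose q : R := m%:R `^ 6^-1.
have q_gt0 : 0 < q by rewrite powR_gt0 ?ltr0n.
have qE n : q ^+ n = m%:R `^ (6^-1 * n%:R).
  by rewrite powRrM powR_mulrn// ltW.
have mq : m%:R = q ^+ 6 by rewrite qE mulVf// powRr1.
have dq : d%:R <= q by rewrite -(@ler_pXn2r _ 6)// ?nnegrE ?(ltW q_gt0)// -mq.
have q1 : 1 <= q by apply: le_trans dq; rewrite ler1n.
have m13 : m%:R `^ (3^-1) = q ^+ 2 by rewrite qE; congr (_ `^ _); lra.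
have m23 : m%:R `^ (2 / 3) = q ^+ 4 by rewrite qE; congr (_ `^ _); lra.
have cE : (m%:R : R) `^ (- (3^-1)) = (q ^+ 2)^-1 by rewrite powRN m13.
have sgE : Num.sqrt (m%:R^-1) = (q ^+ 3)^-1.
  rewrite mq (_ : (q ^+ 6)^-1 = ((q ^+ 3)^-1) ^+ 2); last by rewrite exprVn -exprM.
  by rewrite sqrtr_sqr ger0_norm// invr_ge0 exprn_ge0// ltW.
have [E [mE PE EP]] := good_event P m0 XP q1 Rr1 mq dq sgE cE.
exists E; split=> //; split; first by rewrite m13 mulN1r.
move=> t /EP[W12 aq gridE] W0 b0 a0 W; rewrite m23 => Wv x [xn _].
have x1 : \sum_j x j ^+ 2 = 1.
  have := congr1 (fun z => z ^+ 2) xn.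
  by rewrite /l2norm sqr_sqrtr ?expr1n// sumr_ge0// => j _; exact: sqr_ge0.
have xj j : `|x j| <= 1.
  rewrite -(@ler_pXn2r _ 2)// ?nnegrE// expr1n real_normK ?num_real// -x1.
  by rewrite (bigD1 j)//= lerDl sumr_ge0// => i _; exact: sqr_ge0.
have M0 : (0 < 12 * m ^ 2)%N by rewrite muln_gt0/= expn_gt0 m0.
have [k xk] := grid_approx d _ x M0 xj.
pose e : R := (12 * m ^ 2)%:R^-1.
have e0 : 0 <= e by rewrite invr_ge0.
have p0 : 0 < q^-1 by rewrite invr_gt0.
have p1 : q^-1 <= 1 by rewrite invf_le1.
(* The 12 in the mesh cancels the bound 12 on the weights, so rounding moves a preactivation by at
   most [d * q^-12 <= q^-11]. *)
have e12 : 12 * e = q^-1 ^+ 12.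
  by rewrite /e natrM natrX mq; field; rewrite gt_eqF.
have de : d%:R * (12 * e) <= q^-1 ^+ 11.
  rewrite e12 exprS mulrA -[leRHS]mul1r.
  by rewrite ler_wpM2r ?exprn_ge0 ?(ltW p0)// ler_pdivrMr// mul1r.
have p11 n : (n <= 11)%N -> q^-1 ^+ 11 <= q^-1 ^+ n.
  by move=> n11; apply: ler_wiXn2l => //; exact: ltW.
have e1 : e <= 1.
  by rewrite invf_le1 ?ltr0n// ler1n.
(* The grid point may leave the sphere, but its squared norm stays within the range covered by the
   good event. *)
have k4 : \sum_j grid (12 * m ^ 2) k j ^+ 2 <= (4 : R).
  apply: (sum_sqr_perturb _ x _ _ x1 xk); rewrite -/e.
  have p11_1 := p11 0%N isT; rewrite expr0 in p11_1.
  have d_ge0 : 0 <= d%:R :> R by [].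
  have : d%:R * e ^+ 2 <= d%:R * (12 * e).
    by rewrite ler_wpM2l// expr2; nra.
  lra.
have [net_le count_le] := gridE k k4.
have v0 : 0 <= Rr / q ^+ 4.
  by rewrite divr_ge0 ?exprn_ge0 ?(ltW q_gt0)// (le_trans _ Rr1).
have al0 : 0 <= (q ^+ 2)^-1 by rewrite invr_ge0 exprn_ge0// ltW.
have WK j s : `|W0 j s| <= 12 by rewrite mxE.
have Kev : d%:R * (12 * e) <= Rr / q ^+ 4.
  apply: le_trans de _; apply: le_trans (p11 4%N isT) _.
  by rewrite exprVn ler_peMl// invr_ge0 exprn_ge0// ltW.
have dotpE y s : dotp (col_of W0 s) y + b0 s = preact (X := X) y s t.
  rewrite /preact /dotp; congr (_ + _); apply: eq_bigr => j _.
  by rewrite /col_of mxE.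
have net_le' : `|fnet a0 b0 W0 (grid (12 * m ^ 2) k)| <= 25 / q.
  by rewrite /fnet; under eq_bigr do rewrite dotpE.
have count_le' : \sum_s (`|dotp (col_of W0 s) (grid (12 * m ^ 2) k) + b0 s|
    <= 2 * (Rr / q ^+ 4))%R%:R <= 60 * (Rr * q ^+ 5).
  by under eq_bigr do rewrite dotpE.
apply: le_trans (linearization_error d m a0 b0 W0 W x _ _ _ _ _ _ _ al0 v0 aq WK
  xk x1 Wv Kev net_le' count_le') _.
rewrite -/e (_ : (q ^+ 2)^-1 * (Rr / q ^+ 4 * (60 * (Rr * q ^+ 5))) =
  60 * (Rr ^+ 2 * q^-1)); last by field; rewrite gt_eqF.
(* Rounding costs at most [q^6 * q^-2 * q^-11 = q^-7] over all neurons. *)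
have h1 : m%:R * ((q ^+ 2)^-1 * (d%:R * (12 * e))) <= q^-1.
  apply: (@le_trans _ _ (q ^+ 4 * q^-1 ^+ 11)).
    rewrite (_ : m%:R * _ = q ^+ 4 * (d%:R * (12 * e))); last first.
      by rewrite mq; field; rewrite gt_eqF.
    by rewrite ler_wpM2l// exprn_ge0// ltW.
  rewrite (_ : q ^+ 4 * _ = q^-1 ^+ 7); last by field; rewrite gt_eqF.
  by rewrite -[leRHS]expr1; apply: ler_wiXn2l => //; exact: ltW.
have h2 : q^-1 <= Rr ^+ 2 * q^-1 by rewrite ler_peMl ?(ltW p0)// exprn_ege1.
lra.
Qed.
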